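(* Let $W$ be a finite complex reflection group generated by reflections of order $2$, let $\mathcal{R}$ be its set of reflections, let $\Bbbk$ be a field of characteristic $0$, and let $\mathcal{H}\subset \Bbbk W$ and $\mathcal{H}_{\mathrm{gr}}^r\subset\mathcal{H}$ ($r\ge 1$) be as defined in the context. Then: (i) $\mathcal{H}_{\mathrm{gr}}^1 = Z(\mathcal{H}) \oplus \left( \mathcal{H}' \cap \mathcal{H}_{\mathrm{gr}}^1\right)$ and $\mathcal{H}' \cap \mathcal{H}_{\mathrm{gr}}^1 \subset \mathcal{H}_{\mathrm{gr}}^3$. (ii) For all $r \geq 2$, $\mathcal{H}_{\mathrm{gr}}^r \subset \mathcal{H}' = [\mathcal{H},\mathcal{H}]$ and $\mathcal{H}_{\mathrm{gr}}^r \subset \mathcal{H}_{\mathrm{gr}}^{r+2}$.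
   Context: $\Bbbk W$ is the group algebra, viewed as a Lie algebra with bracket $[a,b]=ab-ba$. The infinitesimal Hecke algebra $\mathcal{H}$ is the Lie $\Bbbk$-subalgebra of $\Bbbk W$ generated by $\mathcal{R}$; $Z(\mathcal{H})$ is its center and $\mathcal{H}'=[\mathcal{H},\mathcal{H}]$. The graded infinitesimal Hecke algebra $\mathcal{H}_{\mathrm{gr}}$ is the Lie $\Bbbk$-subalgebra of $\Bbbk[[h]]W$ generated by the elements $hs$, $s\in\mathcal{R}$; it is graded by the degree in $h$. Its homogeneous part of degree $r$ has the form $h^r\mathcal{H}_{\mathrm{gr}}^r$ for a unique $\Bbbk$-subspace $\mathcal{H}_{\mathrm{gr}}^r\subset\mathcal{H}$; that is, $\mathcal{H}_{\mathrm{gr}}^r$ is the $\Bbbk$-linear span of all iterated Lie brackets of $r$ reflections. *)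

(* Defs.v *)
From HB Require Import structures.
From mathcomp Require Import all_boot all_order all_algebra.
From mathcomp Require Import all_fingroup mxrepresentation.
From mathcomp Require Import boolp classical_sets functions reals.
From mathcomp Require Import complex.

Set Implicit Arguments.
Unset Strict Implicit.
Unset Printing Implicit Defensive.

Import GRing.Theory.
Local Open Scope classical_set_scope.
Local Open Scope ring_scope.

(* Subspaces of a vector space V are sets V -> Prop, as k[[h]]W is infinite
   dimensional; br is the Lie bracket of V. *)
Section LieSubspaces.
Variables (k : fieldType) (V : lmodType k) (br : V -> V -> V).

Definition linear_subspace (S : set V) : Prop :=
  S 0 /\ forall (a : k) x y, S x -> S y -> S (a *: x + y).

Definition linear_span (X : set V) : set V := smallest linear_subspace X.

Definition lie_subalgebra (A L : set V) : Prop :=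
  [/\ L `<=` A, linear_subspace L & forall x y, L x -> L y -> L (br x y)].

Definition lie_generated (A X : set V) : set V := smallest (lie_subalgebra A) X.

Definition lie_center (L : set V) : set V :=
  [set z | L z /\ forall x, L x -> br z x = 0].

Definition lie_derived (L : set V) : set V :=
  linear_span [set br x y | x in L & y in L].

Definition is_direct_sum (U A B : set V) : Prop :=
  U = [set a + b | a in A & b in B] /\ A `&` B = [set 0].

End LieSubspaces.

Definition reflections (F : fieldType) (gT : finGroupType) (W : {group gT})
    (n : nat) (rW : mx_representation F W n) : {set gT} :=
  [set s in W | \rank (rW s - 1%:M) == 1%N]%SET.

Section Hecke.
Variables (k : fieldType) (gT : finGroupType) (W : {group gT}).

(* kW is the library's group ring: the span of the regular representation. *)
Local Notation M := 'M[k]_(gcard W).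

Definition group_algebra : set M := [set x | (x \in group_ring k W)%MS].

Definition bracket (a b : M) : M := a *m b - b *m a.

Definition inf_hecke (refl : {set gT}) : set M :=
  lie_generated bracket group_algebra
    [set regular_repr k W s | s in [set` refl]].

(* As W is finite, k[[h]]W is identified with (kW)[[h]]: a series is the
   sequence of its coefficients, and its product is the Cauchy product. *)
Definition group_algebra_series : set (nat -> M) :=
  [set f | forall i, group_algebra (f i)].

Definition series_mul (f g : nat -> M) : nat -> M :=
  fun m => \sum_(i < m.+1) f i *m g (m - i)%N.

Definition series_bracket (f g : nat -> M) : nat -> M :=
  series_mul f g - series_mul g f.

Definition hmonomial (r : nat) (x : M) : nat -> M :=
  fun i => if i == r then x else 0.

Definition graded_inf_hecke (refl : {set gT}) : set (nat -> M) :=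
  lie_generated series_bracket group_algebra_series
    [set hmonomial 1%N (regular_repr k W s) | s in [set` refl]].

Definition graded_part (refl : {set gT}) (r : nat) : set M :=
  [set x | graded_inf_hecke refl (hmonomial r x)].

End Hecke.

Arguments group_algebra k {gT} W.
Arguments bracket k {gT} W a b.
Arguments inf_hecke k {gT} W refl.
Arguments graded_inf_hecke k {gT} W refl.
Arguments graded_part k {gT} W refl r.

(* Main.v *)
Require Import Defs.
From mathcomp Require Import all_boot all_order all_algebra.
From mathcomp Require Import all_fingroup mxrepresentation.
From mathcomp Require Import boolp classical_sets functions reals complex.
From mathcomp Require Import ring.

(* All reflections of W are involutions: det is +-1 on W, so a reflection 1 + uv
   of finite order has det = 1 + vu = -1. For reflections s, t this gives
   [t, [t, s]] = 2 (s - tst), so modulo the triple brackets every reflection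
   agrees with the mean of its conjugacy class, which is central. A central
   element that is a sum of commutators vanishes by the trace form, so this
   splitting of the span of the reflections is direct and identifies Z(H).
   Replacing s by its noncentral part in [s, t] gives degree 2 inside degree 4,
   and bracketing with reflections propagates the inclusion to higher degrees. *)

Set Implicit Arguments.
Unset Strict Implicit.
Unset Printing Implicit Defensive.

Import GRing.Theory Num.Theory.

Local Open Scope classical_set_scope.
Local Open Scope ring_scope.

(** * Closure properties of linear subspaces and spans *)

Section LinearSubspaces.
Variables (k : fieldType) (V : lmodType k).
Implicit Types (S X : set V) (x y : V).

Lemma linear_subspace0 S : linear_subspace S -> S 0.
Proof. by case. Qed.

Lemma linear_subspaceD S x y : linear_subspace S -> S x -> S y -> S (x + y).
Proof. by case=> _ lS Sx Sy; rewrite -[x]scale1r; apply: lS. Qed.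

Lemma linear_subspaceZ S (a : k) x : linear_subspace S -> S x -> S (a *: x).
Proof. by case=> S0 lS Sx; rewrite -[_ *: _]addr0; apply: lS. Qed.

Lemma linear_subspaceB S x y : linear_subspace S -> S x -> S y -> S (x - y).
Proof. by case=> _ lS Sx Sy; rewrite addrC -scaleN1r; apply: lS. Qed.

Lemma linear_subspace_sum S (I : Type) (r : seq I) (P : pred I) (F : I -> V) :
    linear_subspace S -> (forall i, P i -> S (F i)) ->
  S (\sum_(i <- r | P i) F i).
Proof.
move=> lS SF; apply: big_ind => //; first exact: linear_subspace0.
by move=> x y; apply: linear_subspaceD.
Qed.

Lemma linear_subspace_set0 : linear_subspace [set (0 : V)].
Proof. by split=> // a x y /= -> ->; rewrite scaler0 addr0. Qed.

Lemma linear_subspace_add S T : linear_subspace S -> linear_subspace T ->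
  linear_subspace [set x + y | x in S & y in T].
Proof.
move=> lS lT; split.
  exists 0; first exact: linear_subspace0.
  by exists 0; rewrite ?addr0 //; exact: linear_subspace0.
move=> a _ _ [x Sx [y Ty <-]] [x' Sx' [y' Ty' <-]].
exists (a *: x + x'); first exact: lS.2.
by exists (a *: y + y'); [exact: lT.2 | rewrite scalerDr addrACA].
Qed.

Lemma linear_span_subspace X : linear_subspace (linear_span X).
Proof.
split=> [S [lS _] | a x y Xx Xy S SX]; first exact: lS.1.
by apply: SX.1.2; [apply: Xx | apply: Xy].
Qed.

Lemma sub_linear_span X : X `<=` linear_span X.
Proof. exact: sub_gen_smallest. Qed.

Lemma linear_span_sub X S : linear_subspace S -> X `<=` S -> linear_span X `<=` S.
Proof. exact: smallest_sub. Qed.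

End LinearSubspaces.

(** * Generated Lie subalgebras and their derived subspaces *)

Section LieGenerated.
Variables (k : fieldType) (V : lmodType k) (br : V -> V -> V).
Variables (A X : set V).
Hypotheses (lieA : lie_subalgebra br A A) (XA : X `<=` A).

Lemma sub_lie_generated : X `<=` lie_generated br A X.
Proof. exact: sub_gen_smallest. Qed.

Lemma lie_generated_subalgebra : lie_subalgebra br A (lie_generated br A X).
Proof.
split.
- by apply: smallest_sub.
- split=> [S [[_ lS _] _] | a x y Xx Xy S SX]; first exact: lS.1.
  by have [[_ lS _] _] := SX; apply: lS.2; [apply: Xx | apply: Xy].
- move=> x y Xx Xy S SX; have [[_ _ brS] _] := SX.
  by apply: brS; [apply: Xx | apply: Xy].
Qed.

Lemma lie_generated_sub L :
  lie_subalgebra br A L -> X `<=` L -> lie_generated br A X `<=` L.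
Proof. exact: smallest_sub. Qed.

Lemma lie_derived_subspace (L : set V) : linear_subspace (lie_derived br L).
Proof. exact: linear_span_subspace. Qed.

Lemma bracket_lie_derived (L : set V) x y :
  L x -> L y -> lie_derived br L (br x y).
Proof. by move=> Lx Ly; apply: sub_linear_span; exists x => //; exists y. Qed.

Let L := lie_generated br A X.

Lemma lie_derived_sub : lie_derived br L `<=` L.
Proof.
have [_ lL brL] := lie_generated_subalgebra.
by apply: linear_span_sub => // _ [x Lx [y Ly <-]]; apply: brL.
Qed.

(** The right-hand side lies in [L], so the bracket of any two of its elements falls in the derived
    summand; it is thus a subalgebra containing [X]. Central elements are later split this way. *)
Lemma lie_generated_decomp :
  L `<=` [set x + y | x in linear_span X & y in lie_derived br L].
Proof.
have [LA lL brL] := lie_generated_subalgebra.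
have spL : [set x + y | x in linear_span X & y in lie_derived br L] `<=` L.
  move=> _ [x Xx [y Ly <-]]; apply: (linear_subspaceD lL).
    exact: (linear_span_sub lL sub_lie_generated Xx).
  exact: lie_derived_sub.
apply: lie_generated_sub; first split.
- exact: subset_trans spL LA.
- by apply: linear_subspace_add; apply: linear_span_subspace.
- move=> x y /spL Lx /spL Ly; exists 0.
    exact: linear_subspace0 (linear_span_subspace _).
  by exists (br x y); rewrite ?add0r //; apply: bracket_lie_derived.
- move=> x Xx; exists x; first exact: sub_linear_span.
  by exists 0; rewrite ?addr0 //; apply: linear_subspace0 (linear_span_subspace _).
Qed.

End LieGenerated.

(** * Spans of nested brackets of a fixed length *)

Section LiePower.
Variables (k : fieldType) (V : lmodType k) (br : V -> V -> V) (X : set V).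

(** Only the right-nested brackets [x1, [x2, ..., xr]] are taken; [lie_power_bracket] shows that the
    others add nothing. Degree 0 is the zero space, matching series without constant term. *)
Definition lie_power (r : nat) : set V :=
  if r is r'.+1 then
    iter r' (fun S => linear_span [set br x y | x in X & y in S]) (linear_span X)
  else [set 0].

Lemma lie_powerSS r :
  lie_power r.+2 = linear_span [set br x y | x in X & y in lie_power r.+1].
Proof. by []. Qed.

Lemma lie_power_subspace r : linear_subspace (lie_power r).
Proof.
case: r => [|[|r]]; first exact: linear_subspace_set0.
  exact: linear_span_subspace.
by rewrite lie_powerSS; apply: linear_span_subspace.
Qed.

Lemma lie_power_bracket_gen r x y :
  X x -> lie_power r.+1 y -> lie_power r.+2 (br x y).
Proof. by move=> Xx Ly; apply: sub_linear_span; exists x => //; exists y. Qed.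

End LiePower.

(** * The commutator bracket on the group algebra and on its power series *)

Section Bracket.
Variables (k : fieldType) (gT : finGroupType) (W : {group gT}).
Local Notation M := 'M[k]_(gcard W).
Local Notation br := (bracket k W).
Implicit Types (x y z : M).

Lemma bracketDl (a : k) x y z : br (a *: x + y) z = a *: br x z + br y z.
Proof.
rewrite /bracket mulmxDl mulmxDr -scalemxAl -scalemxAr scalerBr opprD.
by rewrite addrACA.
Qed.

Lemma bracketDr (a : k) x y z : br z (a *: x + y) = a *: br z x + br z y.
Proof.
rewrite /bracket mulmxDl mulmxDr -scalemxAl -scalemxAr scalerBr opprD.
by rewrite addrACA.
Qed.

Lemma bracket0l x : br 0 x = 0.
Proof. by rewrite /bracket mul0mx mulmx0 subrr. Qed.

Lemma bracket0r x : br x 0 = 0.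
Proof. by rewrite /bracket mul0mx mulmx0 subrr. Qed.

Lemma bracket_jacobi x y z : br (br x y) z = br x (br y z) - br y (br x z).
Proof.
rewrite /bracket !(mulmxBl, mulmxBr) !mulmxA.
move: (x *m y *m z) (y *m x *m z) (z *m x *m y) (z *m y *m x)
  (x *m z *m y) (y *m z *m x) => a b c d e f.
by apply/matrixP=> i j; rewrite !mxE; ring.
Qed.

Lemma bracket_lclosed (S T : set M) : linear_subspace T -> forall y,
  (forall x, S x -> T (br x y)) -> forall x, linear_span S x -> T (br x y).
Proof.
move=> lT y brS; apply: linear_span_sub => //; split=> /= [|a u v Tu Tv].
  by rewrite bracket0l; apply: linear_subspace0.
by rewrite bracketDl; apply: lT.2.
Qed.

(** Induction on the depth of the left factor: the Jacobi identity [[s, x], y] = [s, [x, y]] - [x,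
    [s, y]] replaces it by the shallower [x], with [s] either outermost or absorbed into the right
    factor. *)
Lemma lie_power_bracket (X : set M) i j x y :
  lie_power br X i x -> lie_power br X j y -> lie_power br X (i + j) (br x y).
Proof.
case: i => [/= -> _|i].
  rewrite bracket0l.
  exact: (linear_subspace0 (lie_power_subspace br X (0 + j))).
case: j => [_ /= ->|j].
  rewrite bracket0r.
  exact: (linear_subspace0 (lie_power_subspace br X (i.+1 + 0))).
elim: i j x y => [|i IHi] j x y Lx Ly.
  apply: (bracket_lclosed (lie_power_subspace br X (1 + j.+1)) _ Lx) => s Xs.
  exact: lie_power_bracket_gen.
rewrite lie_powerSS in Lx.
apply: (bracket_lclosed (lie_power_subspace br X (i.+2 + j.+1)) _ Lx) => {x Lx}.
move=> _ [s Xs [x Lx <-]]; rewrite bracket_jacobi.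
apply: (linear_subspaceB (lie_power_subspace br X _)).
  rewrite !addSn; apply: lie_power_bracket_gen => //.
  by rewrite -addSn; apply: IHi.
by rewrite addSnnS; apply: IHi => //; apply: lie_power_bracket_gen.
Qed.

Lemma group_algebra_lie :
  lie_subalgebra br (group_algebra k W) (group_algebra k W).
Proof.
have lA : linear_subspace (group_algebra k W).
  split=> [|a x y Ax Ay]; rewrite /group_algebra /= ?linear0 ?sub0mx //.
  by rewrite linearP addmx_sub ?scalemx_sub.
split=> // x y Ax Ay.
by apply: (linear_subspaceB lA); apply: envelop_mxM.
Qed.

Lemma group_algebra_repr w : w \in W -> group_algebra k W (regular_repr k W w).
Proof. exact: envelop_mx_id. Qed.

Lemma hmonomialZD r (a : k) x y :
  hmonomial r (a *: x + y) = a *: hmonomial r x + hmonomial r y.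
Proof.
apply/funext=> i; rewrite !fctE /hmonomial.
by case: eqP => // _; rewrite scaler0 addr0.
Qed.

Lemma hmonomial0 r : hmonomial r (0 : M) = 0.
Proof. by apply/funext=> i; rewrite /hmonomial; case: ifP. Qed.

Lemma series_mul_hmonomial i j x y :
  series_mul (hmonomial i x) (hmonomial j y) = hmonomial (i + j) (x *m y).
Proof.
apply/funext=> m; rewrite /series_mul /hmonomial.
(* Only the summand of index [i] can survive. If [i] exceeds [m] there is none, and then [m] is not
   [i + j] either. *)
have [le_im|lt_mi] := leqP i m; last first.
  rewrite big1 => [|l _]; last first.
    have [El|_] := eqVneq (val l) i; last by rewrite mul0mx.
    by rewrite -El ltnNge -ltnS ltn_ord in lt_mi.
  by case: eqP => // Em; rewrite Em ltnNge leq_addr in lt_mi.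
rewrite (bigD1 (inord i)) //= inordK ?ltnS // eqxx big1 ?addr0 => [|l ne_li].
  rewrite -(eqn_add2l i) subnKC //; by case: ifP => //; rewrite mulmx0.
have [El|_] := eqVneq (val l) i; last by rewrite mul0mx.
by case/eqP: ne_li; apply: val_inj; rewrite /= inordK ?ltnS.
Qed.

Lemma series_bracket_hmonomial i j x y :
  series_bracket (hmonomial i x) (hmonomial j y) = hmonomial (i + j) (br x y).
Proof.
rewrite /series_bracket !series_mul_hmonomial (addnC j) /bracket.
apply/funext=> m; rewrite !fctE /hmonomial.
by case: ifP => // _; rewrite subr0.
Qed.

Lemma series_bracketE (f g : nat -> M) m :
  series_bracket f g m = \sum_(i < m.+1) br (f i) (g (m - i)%N).
Proof.
rewrite /series_bracket !fctE /series_mul /bracket sumrB; congr (_ - _).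
(* Reversing the second Cauchy product pairs [f i] with [g (m - i)] in both products. *)
rewrite (reindex_inj rev_ord_inj) /=; apply: eq_bigr => i _.
by rewrite subSS subKn // -ltnS.
Qed.

End Bracket.

(** * Homogeneous parts of the graded algebra as spans of nested brackets *)

Section GradedParts.
Variables (k : fieldType) (gT : finGroupType) (W : {group gT}).
Variables (T : {set gT}) (sTW : T \subset W).
Local Notation M := 'M[k]_(gcard W).
Local Notation br := (bracket k W).
Local Notation rho := (regular_repr k W).
Local Notation Y := [set rho s | s in [set` T]].

Lemma sub_reflections_group_algebra : Y `<=` group_algebra k W.
Proof.
by move=> _ [s /= Ts <-]; apply/group_algebra_repr/(fintype.subsetP sTW). Qed.

Lemma lie_power_group_algebra r : lie_power br Y r `<=` group_algebra k W.
Proof.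
have [_ lA brA] := group_algebra_lie k W.
case: r => [_ /= ->|]; first exact: linear_subspace0 lA.
elim=> [|r IHr]; first exact: (linear_span_sub lA sub_reflections_group_algebra).
rewrite lie_powerSS; apply: linear_span_sub => // _ [x Yx [y /IHr Ay <-]].
by apply: brA => //; apply: sub_reflections_group_algebra.
Qed.

Lemma group_algebra_series_lie :
  lie_subalgebra (@series_bracket k gT W) (@group_algebra_series k gT W)
    (@group_algebra_series k gT W).
Proof.
have [_ lA brA] := group_algebra_lie k W.
split=> //; first split=> [i | a f g Af Ag i].
- exact: lA.1.
- exact: lA.2.
- move=> f g Af Ag m; rewrite series_bracketE.
  by apply: (linear_subspace_sum _ lA) => i _; apply: brA.
Qed.

Lemma sub_hmonomial_reflections :
  [set hmonomial 1%N (rho s) | s in [set` T]] `<=` @group_algebra_series k gT W.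
Proof.
have [_ lA _] := group_algebra_lie k W.
move=> _ [s Ts <-] i; rewrite /hmonomial; case: ifP => _; last exact: lA.1.
by apply: sub_reflections_group_algebra; exists s.
Qed.

(** The series satisfying this in every degree form a Lie subalgebra, because bracket lengths add in
    the Cauchy product, and this subalgebra contains the generators. *)
Lemma graded_inf_hecke_coef f i :
  graded_inf_hecke k W T f -> lie_power br Y i (f i).
Proof.
move=> Hf; pose L := [set f | forall i, lie_power br Y i (f i)].
suff: L f by [].
move: f Hf {i}; apply: lie_generated_sub; first split.
- by move=> f Lf i; apply: lie_power_group_algebra (Lf i).
- split=> [i | a f g Lf Lg i].
    exact: linear_subspace0 (lie_power_subspace _ _ _).
  exact: (lie_power_subspace br Y i).2.
- move=> f g Lf Lg m; rewrite series_bracketE.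
  apply: (linear_subspace_sum _ (lie_power_subspace br Y m)) => i _.
  have le_im : (i <= m)%N by rewrite -ltnS.
  by rewrite -[X in lie_power _ _ X](subnKC le_im); apply: lie_power_bracket.
- move=> _ [s Ts <-] i /=; rewrite /hmonomial.
  by case: eqP => [->|_]; [apply: sub_linear_span; exists s
                          | apply: linear_subspace0 (lie_power_subspace _ _ _)].
Qed.

(** One inclusion reads off the coefficient in degree [r]; the other builds the monomial of a nested
    bracket one generator at a time. *)
Lemma graded_part_lie_power r :
  (0 < r)%N -> graded_part k W T r = lie_power br Y r.
Proof.
have [HA lH brH] := lie_generated_subalgebra group_algebra_series_lie
  sub_hmonomial_reflections.
case: r => // r _; apply/seteqP; split=> x.
  by move/graded_inf_hecke_coef => /(_ r.+1); rewrite /hmonomial eqxx.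
have lP i : linear_subspace [set x : M | graded_inf_hecke k W T (hmonomial i x)].
  split=> [|a y z Hy Hz] /=; first by rewrite hmonomial0; apply: lH.1.
  by rewrite hmonomialZD; apply: lH.2.
have genP s : s \in T -> graded_inf_hecke k W T (hmonomial 1 (rho s)).
  by move=> Ts; apply: sub_lie_generated; exists s.
elim: r x => [|r IHr] x.
  by apply: (linear_span_sub (lP 1%N)) => _ [s Ts <-]; apply: genP.
rewrite lie_powerSS; apply: (linear_span_sub (lP r.+2)).
move=> _ [_ [s Ts <-] [y /IHr Hy <-]] /=.
by rewrite -add1n -series_bracket_hmonomial; apply: brH => //; apply: genP.
Qed.
End GradedParts.

(** * Central elements and the trace form of the group algebra *)

Section CentralElements.
Variables (k : fieldType) (gT : finGroupType) (W : {group gT}).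
Local Notation M := 'M[k]_(gcard W).
Local Notation br := (bracket k W).
Local Notation rho := (regular_repr k W).
Hypothesis k_char0 : [pchar k] =i pred0.

Lemma card_group_neq0 : #|W|%:R != 0 :> k.
Proof. by rewrite ((pcharf0P k).1 k_char0) -lt0n cardG_gt0. Qed.

(** This is the class sum of [g] times the order of its centralizer; summing over [W] instead of the
    class makes centrality a translation of the index. *)
Definition conj_sum g : M := \sum_(w in W) rho (g ^ w)%g.

Lemma conj_sum_central g v :
  g \in W -> v \in W -> conj_sum g *m rho v = rho v *m conj_sum g.
Proof.
move=> Wg Wv; rewrite mulmx_suml mulmx_sumr.
rewrite [RHS](reindex_inj (mulIg v)) /=.
apply: eq_big => [w|w Ww]; first by rewrite groupMr.
by rewrite -!repr_mxM ?groupJ ?groupM // conjgM (conjgC (g ^ w)).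
Qed.

(** Translation by a nontrivial element fixes no point of [W], so its permutation matrix has zero
    diagonal. *)
Lemma regular_trace x : x \in W -> \tr (rho x) = (x == 1%g)%:R * #|W|%:R.
Proof.
move=> Wx; have [->|ne_x1] := eqVneq x 1%g.
  by rewrite repr_mx1 mxtrace1 mul1r.
rewrite mul0r; apply: big1 => i _; rewrite !mxE /=.
case: eqP => //= Ei; case/eqP: ne_x1.
have := congr1 enum_val Ei; rewrite gring_indexK ?groupM ?enum_valP //.
by move=> Ex; apply: (mulgI (enum_val i)); rewrite mulg1 -Ex.
Qed.

Lemma group_algebra_commute z x :
    (forall w, w \in W -> z *m rho w = rho w *m z) ->
  group_algebra k W x -> z *m x = x *m z.
Proof.
move=> cz /envelop_mxP[a ->]; rewrite mulmx_suml mulmx_sumr.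
by apply: eq_bigr => w Ww; rewrite -scalemxAl -scalemxAr cz.
Qed.

(* Against a central element the trace form kills commutators, so a central z
   has tr (z * conj_sum g) = |W| tr (z * g), a multiple of a coefficient of z. *)
Lemma central_commutator_eq0 z :
    group_algebra k W z -> (forall w, w \in W -> z *m rho w = rho w *m z) ->
  lie_derived br (group_algebra k W) z -> z = 0.
Proof.
move=> Az cz Dz.
have trD g x : g \in W -> lie_derived br (group_algebra k W) x ->
    \tr (x *m conj_sum g) = 0.
  move=> Wg; pose N := [set x : M | \tr (x *m conj_sum g) = 0].
  have lN : linear_subspace N.
    split=> [|a u v /= Nu Nv]; first by rewrite /N /= mul0mx mxtrace0.
    by rewrite /N /= mulmxDl -scalemxAl mxtraceD mxtraceZ Nu Nv mulr0 addr0.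
  move=> Dx; suff: N x by [].
  apply: (linear_span_sub lN _ Dx) => _ [a Aa [b Ab <-]]; rewrite /N /= /bracket.
  have cb := group_algebra_commute (fun v Wv => conj_sum_central Wg Wv) Ab.
  rewrite mulmxBl raddfB /= -!mulmxA [\tr (b *m _)]mxtrace_mulC -mulmxA cb.
  exact: subrr.
have trz g : g \in W -> \tr (z *m rho g) = 0.
  move=> Wg; apply: (mulIf card_group_neq0); rewrite mul0r -(trD g z) //.
  rewrite mulmx_sumr raddf_sum /= mulr_natr -sumr_const; apply: eq_bigr => w Ww.
  rewrite repr_mxM ?groupM ?groupV // mulmxA [RHS]mxtrace_mulC.
  rewrite [LHS]mxtrace_mulC cz ?groupV // mulmxA -repr_mxM ?groupM ?groupV //.
  by rewrite -mulgA mulgV mulg1.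
have [a Ez] := envelop_mxP Az; rewrite Ez big1 // => x Wx.
(* Pairing with the inverse of [x] leaves only the summand at [x], which contributes its coefficient
   times the order of [W]. *)
have := trz x^-1%g; rewrite groupV Wx => /(_ isT).
rewrite Ez mulmx_suml raddf_sum (bigD1 x) //= big1 => [|y /andP[Wy ne_yx]].
  rewrite -scalemxAl mxtraceZ -repr_mxM ?groupV //.
  rewrite regular_trace ?groupM ?groupV //.
  rewrite mulgV eqxx mul1r addr0 => /eqP.
  by rewrite mulf_eq0 (negPf card_group_neq0) orbF => /eqP->; rewrite scale0r.
rewrite -scalemxAl mxtraceZ -repr_mxM ?groupV //.
  rewrite regular_trace ?groupM ?groupV //.
by rewrite -eq_mulgV1 (negPf ne_yx) mul0r mulr0.
Qed.

End CentralElements.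

(** * Groups generated by a conjugation-stable set of involutions *)

Section InvolutionGenerated.
Variables (k : fieldType) (gT : finGroupType) (W : {group gT}) (T : {set gT}).
Local Notation M := 'M[k]_(gcard W).
Local Notation br := (bracket k W).
Local Notation rho := (regular_repr k W).
Local Notation Y := [set rho s | s in [set` T]].
(** This will turn out to be the center of [H], by [lie_center_span]. *)
Local Notation central_span :=
  [set c : M | linear_span Y c /\ forall w, w \in W -> c *m rho w = rho w *m c].
Hypothesis k_char0 : [pchar k] =i pred0.
Hypothesis sTW : T \subset W.
Hypothesis genT : (<<T>> = W)%g.
Hypothesis TJ : forall s w, s \in T -> w \in W -> (s ^ w)%g \in T.
Hypothesis T2 : forall s, s \in T -> (s * s = 1)%g.

(** The double bracket expands to tts - 2 tst + stt, where tt = 1; as [t] is its own inverse, tst is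
    the conjugate of [s]. *)
Lemma bracket_involution s t : s \in T -> t \in T ->
  br (rho t) (br (rho t) (rho s)) = 2 *: (rho s - rho (s ^ t)%g).
Proof.
move=> Ts Tt; have [Ws Wt] : s \in W /\ t \in W.
  by split; apply: (fintype.subsetP sTW).
have -> : (s ^ t = t * s * t)%g.
  by rewrite /conjg mulgA -[in LHS](mulg1 t^-1%g) -(T2 Tt) mulKg.
rewrite !repr_mxM ?groupM // /bracket !(mulmxBl, mulmxBr) !mulmxA.
rewrite -!(mulmxA (rho s)) -(repr_mxM _ Wt Wt) T2 // repr_mx1 mul1mx mulmx1.
move: (rho s) (rho t *m rho s *m rho t) => a b.
by apply/matrixP=> i j; rewrite !mxE; ring.
Qed.

(** The [w] that work for all [s] at once form a subgroup of [W], and it contains the generators by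
    [bracket_involution]. *)
Lemma reflection_sub_conj (S : set M) s w : linear_subspace S ->
    (forall s t, s \in T -> t \in T -> S (br (rho t) (br (rho t) (rho s)))) ->
  s \in T -> w \in W -> S (rho s - rho (s ^ w)%g).
Proof.
move=> lS brS Ts Ww.
pose G := [set w in W | `[< forall s, s \in T -> S (rho s - rho (s ^ w)%g) >]]%SET.
have gG : group_set G.
  apply/group_setP; split=> [|u v].
    rewrite inE group1; apply/asboolP=> t _; rewrite conjg1 subrr.
    exact: linear_subspace0.
  rewrite !inE => /andP[Wu /asboolP Su] /andP[Wv /asboolP Sv].
  rewrite groupM //; apply/asboolP => t Tt.
  (* Telescoping through the conjugate of [t] by [u], which is again in [T], so the hypothesis on
     [v] applies to it. *)
  rewrite -(subrKA (rho (t ^ u)%g)) conjgM.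
  by apply: (linear_subspaceD lS); [apply: Su | apply/Sv/TJ].
have: W \subset Group gG.
  rewrite -genT gen_subG; apply/fintype.subsetP=> t Tt; rewrite inE.
  rewrite (fintype.subsetP sTW) //; apply/asboolP=> r Tr.
  (* The factor 2 of the double bracket has to be inverted. *)
  have n2 : 2 != 0 :> k by rewrite ((pcharf0P k).1 k_char0).
  rewrite -[_ - _](scalerK n2) -bracket_involution //.
  by apply: (linear_subspaceZ _ lS); apply: brS.
by move/fintype.subsetP/(_ w Ww); rewrite inE => /andP[_ /asboolP]; apply.
Qed.

(** Each [s] is the mean of its conjugates, which is central, plus the mean of the differences
    [s - s ^ w], which lie in [S]. *)
Lemma linear_span_decomp (S : set M) : linear_subspace S ->
    (forall s t, s \in T -> t \in T -> S (br (rho t) (br (rho t) (rho s)))) ->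
  linear_span Y `<=` [set c + d | c in central_span & d in S].
Proof.
move=> lS brS; have lY := linear_span_subspace Y.
apply: linear_span_sub.
  apply: linear_subspace_add => //; split=> [|a u v [Yu cu] [Yv cv]].
    by split=> [|w _]; [exact: lY.1 | rewrite mul0mx mulmx0].
  split=> [|w Ww]; first exact: lY.2.
  by rewrite mulmxDl mulmxDr -scalemxAl -scalemxAr cu // cv.
move=> _ [s Ts <-]; have Ws := fintype.subsetP sTW _ Ts.
pose N : k := #|W|%:R; have nN : N != 0 by apply: card_group_neq0.
exists (N^-1 *: conj_sum k W s).
  split=> [|w Ww]; last by rewrite -scalemxAl -scalemxAr conj_sum_central.
  apply: (linear_subspaceZ _ lY); apply: (linear_subspace_sum _ lY) => w Ww.
  by apply: sub_linear_span; exists (s ^ w)%g => //; apply: TJ.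
exists (N^-1 *: \sum_(w in W) (rho s - rho (s ^ w)%g)).
  apply: (linear_subspaceZ _ lS); apply: (linear_subspace_sum _ lS) => w Ww.
  exact: reflection_sub_conj.
rewrite sumrB sumr_const -scaler_nat scalerBr scalerK //.
by rewrite addrC subrK.
Qed.

Local Notation H := (inf_hecke k W T).
Local Notation H' := (lie_derived br H).
Local Notation Hgr := (graded_part k W T).

Let lieH : lie_subalgebra br (group_algebra k W) H.
Proof.
exact: lie_generated_subalgebra (group_algebra_lie k W)
  (sub_reflections_group_algebra sTW).
Qed.

Let span_H : linear_span Y `<=` H.
Proof.
by have [_ lH _] := lieH; apply: (linear_span_sub lH); apply: sub_lie_generated.
Qed.

Let H_gen s : s \in T -> H (rho s).
Proof. by move=> Ts; apply: span_H; apply: sub_linear_span; exists s. Qed.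

(** Commutators of [H] are commutators of the whole group algebra, where the trace form argument
    applies. *)
Lemma central_derived_eq0 z :
  (forall w, w \in W -> z *m rho w = rho w *m z) -> H' z -> z = 0.
Proof.
have [HA _ _] := lieH.
have dA : H' `<=` lie_derived br (group_algebra k W).
  apply: linear_span_sub; first exact: lie_derived_subspace.
  by move=> _ [x /HA Ax [y /HA Ay <-]]; apply: bracket_lie_derived.
move=> cz Dz; apply: (central_commutator_eq0 k_char0) cz (dA _ Dz).
apply: HA; exact: (lie_derived_sub (group_algebra_lie k W)
  (sub_reflections_group_algebra sTW) Dz).
Qed.

(** The elements of [W] commuting with [z] form a subgroup that contains the generating set [T]. *)
Lemma lie_center_commute z w :
  lie_center br H z -> w \in W -> z *m rho w = rho w *m z.
Proof.
move=> [_ cz] Ww.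
have: W \subset rcent rho z.
  rewrite -genT gen_subG; apply/fintype.subsetP=> t Tt; rewrite inE.
  rewrite (fintype.subsetP sTW) //= -subr_eq0; apply/eqP.
  exact: (cz _ (H_gen Tt)).
by move/fintype.subsetP/(_ w Ww); rewrite inE => /andP[_ /eqP].
Qed.

Lemma central_span_bracket c x : central_span c -> H x -> br c x = 0.
Proof.
move=> [_ cc] Hx; have [HA _ _] := lieH.
by apply/eqP; rewrite subr_eq0 (group_algebra_commute cc) //; apply: HA.
Qed.

(** Landing in both spaces at once lets a single decomposition serve the direct sum and the
    inclusion in degree 3. *)
Let brD s t : s \in T -> t \in T ->
  (lie_power br Y 3 `&` H') (br (rho t) (br (rho t) (rho s))).
Proof.
move=> Ts Tt; have [_ _ brH] := lieH; split.
  apply: lie_power_bracket_gen; first by exists t.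
  by apply: lie_power_bracket_gen; [exists t | apply: sub_linear_span; exists s].
by apply: bracket_lie_derived; [|apply: brH]; apply: H_gen.
Qed.

Let lD : linear_subspace (lie_power br Y 3 `&` H').
Proof.
have [l3 lH'] := (lie_power_subspace br Y 3, lie_derived_subspace br H).
split=> [|a x y [x3 x'] [y3 y']]; first by split; [exact: l3.1 | exact: lH'.1].
by split; [exact: l3.2 | exact: lH'.2].
Qed.

Lemma span_decomp :
  linear_span Y `<=`
    [set c + d | c in central_span & d in lie_power br Y 3 `&` H'].
Proof. exact: linear_span_decomp. Qed.

Lemma lie_power_sub_derived r : lie_power br Y r.+2 `<=` H'.
Proof.
have lH' := lie_derived_subspace br H; have [_ lH _] := lieH.
elim: r => [|r IHr].
  apply: (linear_span_sub lH') => _ [_ [s Ts <-] [y Yy <-]].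
  by apply: bracket_lie_derived; [exact: H_gen | exact: span_H].
apply: (linear_span_sub lH') => _ [_ [s Ts <-] [y /IHr Hy <-]].
apply: bracket_lie_derived; first exact: H_gen.
exact: (lie_derived_sub (group_algebra_lie k W)
  (sub_reflections_group_algebra sTW) Hy).
Qed.

Lemma lie_power_sub_add2 r : lie_power br Y r.+2 `<=` lie_power br Y r.+4.
Proof.
elim: r => [|r IHr].
  apply: (linear_span_sub (lie_power_subspace br Y 4)).
  move=> _ [_ [s Ts <-] [y Yy <-]].
  have Ys : linear_span Y (rho s) by apply: sub_linear_span; exists s.
  have [c cc [d [d3 _] <-]] := span_decomp Ys.
  (* The central part of [s] drops out of the bracket; what remains pairs degree 3 with degree 1. *)
  rewrite -[c]scale1r bracketDl central_span_bracket ?scaler0 ?add0r //;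
    last exact: span_H.
  exact: (lie_power_bracket (i := 3) (j := 1)).
apply: (linear_span_sub (lie_power_subspace br Y r.+2.+3)).
by move=> _ [x Yx [y /IHr Hy <-]]; apply: lie_power_bracket_gen.
Qed.

(** In [x = c + d] the central part [c = x - d] lies in [H'], hence vanishes, and [x] is the degree
    3 part [d]. *)
Lemma span_derived_lie_power3 : H' `&` linear_span Y `<=` lie_power br Y 3.
Proof.
move=> x [H'x /span_decomp[c [Yc cc] [d [d3 d'] Ex]]].
rewrite -Ex (central_derived_eq0 cc) ?add0r //.
have -> : c = x - d by rewrite -Ex addrK.
exact: (linear_subspaceB (lie_derived_subspace br H)).
Qed.

(** A central [z] is [c + d + y] with [c] in the central span and [d], [y] in [H']; then [z - c] is
    central and in [H'], so it is zero. *)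
Lemma lie_center_span : lie_center br H = central_span.
Proof.
apply/seteqP; split=> [z Zz | c cc]; last first.
  by split=> [|x]; [exact: span_H cc.1 | exact: central_span_bracket].
have cz w := @lie_center_commute z w Zz; split=> //.
have [x Yx [y H'y Ez]] :=
  lie_generated_decomp (group_algebra_lie k W)
    (sub_reflections_group_algebra sTW) Zz.1.
have [c [Yc cc] [d [d3 d'] Ex]] := span_decomp Yx.
suff -> : z = c by [].
apply/eqP; rewrite -subr_eq0; apply/eqP/central_derived_eq0 => [w Ww|].
  by rewrite mulmxBl mulmxBr cz // cc.
have -> : z - c = d + y by rewrite -Ez -Ex -[c + d + y]addrA [LHS]addrC addKr.
exact: (linear_subspaceD (lie_derived_subspace br H)).
Qed.

Lemma span_direct_sum :
  is_direct_sum (linear_span Y) (lie_center br H) (H' `&` linear_span Y).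
Proof.
have lY := linear_span_subspace Y.
rewrite lie_center_span; split; apply/seteqP; split.
- move=> x Yx; have [c [Yc cc] [d [d3 d'] Ex]] := span_decomp Yx.
  exists c => //; exists d => //; split=> //.
  (* The remainder [d] is also in the span, since both [x] and [c] are. *)
  have -> : d = x - c by rewrite -Ex addrC addKr.
  exact: (linear_subspaceB lY).
- by move=> _ [c [Yc _] [d [_ Yd] <-]]; apply: (linear_subspaceD lY).
- by move=> z [[_ cz] [H'z _]]; apply: central_derived_eq0.
- move=> _ ->; split; split.
  + exact: lY.1.
  + by move=> w _; rewrite mul0mx mulmx0.
  + exact: (lie_derived_subspace br H).1.
  + exact: lY.1.
Qed.

End InvolutionGenerated.

(** * Determinants and orders of complex reflections *)

Lemma det_add1_mulmx (R : comPzRingType) (m n : nat)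
    (u : 'M[R]_(m, n)) (v : 'M[R]_(n, m)) :
  \det (1%:M + u *m v) = \det (1%:M + v *m u).
Proof.
(* Sylvester's identity: one block matrix is factored in two ways sharing a unitriangular factor, so
   the other two factors have equal determinants. *)
have : block_mx 1%:M 0 v 1%:M *m block_mx (1%:M + u *m v) u 0 1%:M
    = block_mx 1%:M u 0 (1%:M + v *m u) *m block_mx 1%:M 0 v 1%:M.
  rewrite !mulmx_block !(mul0mx, mulmx0, mul1mx, mulmx1, addr0, add0r).
  by rewrite mulmxDl mulmxDr mul1mx mulmx1 mulmxA (addrC 1%:M (v *m u)).
move/(congr1 determinant).
by rewrite !det_mulmx !det_ublock !det_lblock !det1 !mul1r !mulr1.
Qed.

Section ComplexReflections.
Variables (F : numFieldType) (gT : finGroupType) (W : {group gT}) (n : nat).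
Variable rW : mx_representation F W n.

(** Conjugating [rW s - 1] by an invertible matrix preserves its rank. *)
Lemma reflectionsJ s w :
  s \in reflections rW -> w \in W -> (s ^ w)%g \in reflections rW.
Proof.
rewrite !inE => /andP[Ws rk_s] Ww; rewrite groupJ //=.
have -> : rW (s ^ w)%g - 1%:M = rW w^-1%g *m (rW s - 1%:M) *m rW w.
  rewrite /conjg !repr_mxM ?groupM ?groupV // mulmxBr mulmxBl mulmx1 mulmxA.
  by rewrite -[rW _^-1%g *m rW w]repr_mxM ?groupV // mulVg repr_mx1.
rewrite mxrankMfree ?row_free_unit ?repr_mx_unit //.
by rewrite eqmxMfull ?row_full_unit ?repr_mx_unit ?groupV.
Qed.

(* With a = vu for s = 1 + uv, the case a = 0 is excluded by s^m = 1 + m uv. *)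
Lemma reflection_involution s : mx_faithful rW -> \det (rW s) ^+ 2 == 1 ->
  s \in reflections rW -> (s * s = 1)%g.
Proof.
move=> faithW det2; rewrite inE => /andP[Ws /eqP rk1].
(* Full-rank factorization of a rank one matrix into a column and a row. *)
have [u [v Euv]] : exists (u : 'cV[F]_n) (v : 'rV[F]_n), rW s - 1%:M = u *m v.
  rewrite -(mulmx_base (rW s - 1%:M)).
  by move: (col_base _) (row_base _); rewrite rk1 => u v; exists u, v.
have Es : rW s = 1%:M + u *m v by rewrite -Euv addrC subrK.
pose a := (v *m u) 0 0; have Ea : v *m u = a%:M by apply: mx11_scalar.
have Euv2 : u *m v *m (u *m v) = a *: (u *m v).
  by rewrite mulmxA -(mulmxA u) Ea mul_mx_scalar scalemxAl.
have det_s : \det (rW s) = 1 + a.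
  by rewrite Es det_add1_mulmx Ea -raddfD det_scalar1.
(* The square of the determinant minus 1 is a (a + 2). *)
have: (a == 0) || (a == -2).
  rewrite -(addr_eq0 a 2) -mulf_eq0.
  move: det2; rewrite -subr_eq0 det_s => /eqP det2.
  by apply/eqP; rewrite -[RHS]det2; ring.
case/orP=> /eqP Ea0.
  have rWX m : rW (s ^+ m)%g = 1%:M + m%:R *: (u *m v).
    elim: m => [|m IHm]; first by rewrite expg0 repr_mx1 scale0r addr0.
    rewrite expgSr repr_mxM ?groupX // IHm Es mulmxDl mul1mx mulmxDr mulmx1.
    rewrite -scalemxAl Euv2 Ea0 scale0r scaler0 addr0 -natr1 scalerDl scale1r.
    by rewrite -addrA (addrC (u *m v)).
  (* At the order of [s] the power formula forces uv = 0, against rank one. *)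
  have := rWX #[s]%g; rewrite expg_order repr_mx1 -[LHS]addr0 => /addrI/esym/eqP.
  rewrite scaler_eq0 pnatr_eq0 eqn0Ngt order_gt0 /= -Euv => /eqP E0.
  by rewrite E0 mxrank0 in rk1.
(* With a = -2 the square of 1 + uv is 1 + (2 + a) uv = 1. *)
apply: (mx_faithful_inj faithW); rewrite ?groupM // repr_mx1 repr_mxM // Es.
rewrite mulmxDl !mulmxDr !mul1mx mulmx1 Euv2 Ea0.
move: (u *m v) => b; apply/matrixP=> i j; rewrite !mxE; ring.
Qed.

(** By multiplicativity of the determinant the condition cuts out a subgroup, and it holds for every
    generator since t t = 1. *)
Lemma det_generated_involutions w :
    (W :=: <<[set s in reflections rW | #[s] == 2%N]%SET>>)%g ->
  w \in W -> \det (rW w) ^+ 2 == 1.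
Proof.
move=> genW Ww.
pose G := [set w in W | \det (rW w) ^+ 2 == 1]%SET.
have gG : group_set G.
  apply/group_setP; split=> [|u v].
    by rewrite inE group1 repr_mx1 det1 expr1n eqxx.
  rewrite !inE => /andP[Wu /eqP u1] /andP[Wv /eqP v1].
  by rewrite groupM // repr_mxM // det_mulmx exprMn u1 v1 mulr1 eqxx.
have: W \subset Group gG.
  rewrite {1}genW gen_subG; apply/fintype.subsetP=> t.
  rewrite !inE => /andP[/andP[Wt _] /eqP t2]; rewrite Wt /=.
  rewrite expr2 -det_mulmx -repr_mxM // -[(t * t)%g]/(t ^+ 2)%g -t2.
  by rewrite expg_order repr_mx1 det1.
by move/fintype.subsetP/(_ w Ww); rewrite inE => /andP[].
Qed.

End ComplexReflections.

Theorem proposition2p1 (R : realType) (gT : finGroupType) (W : {group gT})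
    (n : nat) (rW : mx_representation R[i] W n) (k : fieldType)
    (W_faithful : mx_faithful rW)
    (W_gen : (W :=: <<[set s in reflections rW | #[s] == 2%N]%SET>>)%g)
    (k_char0 : [pchar k] =i pred0) :
  let refl := reflections rW in
  let H := inf_hecke k W refl in
  let H' := lie_derived (bracket k W) H in
  let Hgr := graded_part k W refl in
  (is_direct_sum (Hgr 1%N) (lie_center (bracket k W) H) (H' `&` Hgr 1%N)
     /\ H' `&` Hgr 1%N `<=` Hgr 3%N)
  /\ (forall r : nat, (2 <= r)%N -> Hgr r `<=` H' /\ Hgr r `<=` Hgr (r + 2)%N).
Proof.
move=> refl H H' Hgr.
have sTW : refl \subset W by apply/fintype.subsetP=> s; rewrite inE => /andP[].
(* [refl] holds all reflections, so it contains the generators of order 2 and still lies in [W]. *)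
have genT : (<<refl>> = W)%g.
  apply/eqP; rewrite finset.eqEsubset gen_subG sTW /= {1}W_gen genS //.
  by apply/fintype.subsetP=> s; rewrite inE => /andP[].
have TJ : forall s w, s \in refl -> w \in W -> (s ^ w)%g \in refl.
  exact: reflectionsJ.
(* Involutivity is needed for every reflection of [W], while it is assumed only for the generators;
   the determinant carries it over. *)
have T2 s : s \in refl -> (s * s = 1)%g.
  move=> Ts; apply: (reflection_involution W_faithful _ Ts).
  exact: det_generated_involutions W_gen (fintype.subsetP sTW _ Ts).
have Hgr1 : Hgr 1%N = linear_span [set regular_repr k W s | s in [set` refl]].
  exact: graded_part_lie_power.
split; first rewrite Hgr1; first split.
- exact: span_direct_sum.
- rewrite /Hgr graded_part_lie_power //; exact: span_derived_lie_power3.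
- case=> [|[|r]] // _; rewrite /Hgr !graded_part_lie_power ?addn2 //.
  by split; [exact: lie_power_sub_derived | exact: lie_power_sub_add2].
Qed.
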